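(* Let $t(n,k)$ be the number of paths in $\mathcal{M}'_2$ of length $n$ whose end-point has height $k$, and $\mathcal{T}=[t(n,k)]_{n\geq 0, k \geq 0}$. Then $\mathcal{T}=A\cdot B$, where the matrices $A$ and $B$ are defined as follows. (1) $B=[b_{n,k}]_{n,k\geq 0}$ is given by $b_{0,0}=1$, $b_{n,0}=b_{0,n}=0$ if $n\geq 1$, and $b_{n,k}=\binom{k-1}{n-1}$ otherwise. (2) $A=[a_{n,k}]_{n,k\geq 0}$ is the almost stretched Riordan array whose initial column has generating function $$g_0(z)=1+zM(z)=\frac{1+z-\sqrt{1-2z-3z^2}}{2z},$$ followed by the shifted stretched Riordan array $(g(z),z^2g(z))$, where $$g(z)=\frac{1-z-2z^2-\sqrt{1-2z-3z^2}}{2z^3(1+z)}.$$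
   Context: $\mathcal{M}'_2$ is the set of lattice paths in $\mathbb{N}^2$ (with $\mathbb{N}=\{0,1,2,\dots\}$, so paths never go below the $x$-axis) starting at the origin, made of up steps $(1,k)$ with $k\ge 1$, down steps $(1,-1)$ and horizontal steps $(1,0)$, in which every up step and every horizontal step, except possibly when it is the first step of the path, is immediately preceded by a down step. The empty path belongs to $\mathcal{M}'_2$. The length of a path is its number of steps; the height of a point is its ordinate. $M(z)=\frac{1-z-\sqrt{1-2z-3z^2}}{2z^2}$ is the generating function of the Motzkin numbers. An almost Riordan array (of order $1$) with initial column of generating function $g_0(z)$ followed by the shifted array $(g(z),f(z))$ is the matrix whose column $0$ has generating function $g_0(z)$ and whose column $k\ge1$ has generating function $z\,g(z)f(z)^{k-1}$; its bivariate generating function is $g_0(z)+zu\frac{g(z)}{1-uf(z)}$. ''Stretched'' refers to the fact that $f(z)$ (here $z^2g(z)$) has order greater than $1$ at $z=0$. Square roots are power series with constant term $1$. *)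

(* Defs.v *)
From HB Require Import structures.
From mathcomp Require Import all_boot all_order all_algebra.
From mathcomp Require Import finmap.
From mathcomp Require Import boolp classical_sets functions cardinality fsbigop.

Set Implicit Arguments.
Unset Strict Implicit.
Unset Printing Implicit Defensive.
Import Order.TTheory GRing.Theory Num.Theory.
Local Open Scope ring_scope.

(* MathComp has no ring of formal power series, so Q[[z]] is built here, with *)
(* the Cauchy product as multiplication. The record wrapper keeps it apart    *)
(* from the pointwise ring of functions nat -> rat.                           *)
Record fps := Fps { coef : nat -> rat }.

HB.instance Definition _ := gen_eqMixin fps.
HB.instance Definition _ := gen_choiceMixin fps.

Lemma fpsP (a b : fps) : coef a =1 coef b <-> a = b.
Proof. by split=> [|-> //]; case: a b => [a] [b] /= /funext ->. Qed.

Definition fps_zero := Fps (fun=> 0).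
Definition fps_one := Fps (fun n => (n == 0)%:R).
Definition fps_opp a := Fps (fun n => - coef a n).
Definition fps_add a b := Fps (fun n => coef a n + coef b n).
Definition fps_mul a b := Fps (fun n => \sum_(i < n.+1) coef a i * coef b (n - i)).

Section FpsRing.

Let tr m a := \poly_(i < m) coef a i.

Let tr_mul m a b n : (n < m)%N -> coef (fps_mul a b) n = (tr m a * tr m b)`_n.
Proof.
move=> nm; rewrite coefM; apply: eq_bigr => i _.
by rewrite !coef_poly (leq_ltn_trans (leq_subr _ _) nm) (leq_ltn_trans _ nm) // -ltnS.
Qed.

Fact fps_addA : associative fps_add.
Proof. by move=> a b c; apply/fpsP => n /=; rewrite addrA. Qed.
Fact fps_addC : commutative fps_add.
Proof. by move=> a b; apply/fpsP => n /=; rewrite addrC. Qed.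
Fact fps_add0 : left_id fps_zero fps_add.
Proof. by move=> a; apply/fpsP => n /=; rewrite add0r. Qed.
Fact fps_addN : left_inverse fps_zero fps_opp fps_add.
Proof. by move=> a; apply/fpsP => n /=; rewrite addNr. Qed.

Fact fps_mulC : commutative fps_mul.
Proof. by move=> a b; apply/fpsP => n; rewrite !(@tr_mul n.+1) // mulrC. Qed.

Fact fps_mulA : associative fps_mul.
Proof.
move=> a b c; apply/fpsP => n.
have -> : coef (fps_mul a (fps_mul b c)) n = (tr n.+1 a * (tr n.+1 b * tr n.+1 c))`_n.
  rewrite [RHS]coefM; apply: eq_bigr => i _.
  by rewrite coef_poly ltn_ord -tr_mul // ltnS leq_subr.
rewrite mulrA [RHS]/= coefM; apply: eq_bigr => i _.
by rewrite coef_poly ltnS leq_subr -tr_mul.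
Qed.

Fact fps_mul1 : left_id fps_one fps_mul.
Proof.
move=> a; apply/fpsP => n /=; rewrite big_ord_recl /= mul1r subn0 big1 ?addr0 //.
by move=> i _; rewrite mul0r.
Qed.

Fact fps_mulDl : left_distributive fps_mul fps_add.
Proof.
move=> a b c; apply/fpsP => n /=; rewrite -big_split /=.
by apply: eq_bigr => i _; rewrite mulrDl.
Qed.

Fact fps_one_neq0 : fps_one != fps_zero.
Proof. by apply/eqP => /fpsP /(_ 0%N) /eqP; rewrite oner_eq0. Qed.

End FpsRing.

HB.instance Definition _ :=
  GRing.isZmodule.Build fps fps_addA fps_addC fps_add0 fps_addN.
HB.instance Definition _ :=
  GRing.Zmodule_isComNzRing.Build fps
    fps_mulA fps_mulC fps_mul1 fps_mulDl fps_one_neq0.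

Lemma fps_coef0 n : coef 0 n = 0. Proof. by []. Qed.
Lemma fps_coef1 n : coef 1 n = (n == 0)%:R. Proof. by []. Qed.
Lemma fps_coefN a n : coef (- a) n = - coef a n. Proof. by []. Qed.
Lemma fps_coefD a b n : coef (a + b) n = coef a n + coef b n. Proof. by []. Qed.
Lemma fps_coefM a b n : coef (a * b) n = \sum_(i < n.+1) coef a i * coef b (n - i).
Proof. by []. Qed.

Definition zvar : fps := Fps (fun n => (n == 1)%:R).
Notation "''z'" := zvar : ring_scope.

(* The series c with b * c = a when b divides a in Q[[z]] (see fps_divP), and *)
(* 0 otherwise; b need not be invertible, e.g. fps_div ('z ^+ 2) 'z = 'z.     *)
Definition fps_div (a b : fps) : fps := xget 0 [set c | b * c = a]%classic.

Definition fps_sqrt (a : fps) : fps :=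
  xget 0 [set s | coef s 0 = 1 /\ s ^+ 2 = a]%classic.

Lemma fps_mulf_neq0 (a b : fps) : a != 0 -> b != 0 -> a * b != 0.
Proof.
have ord (c : fps) : c != 0 ->
    exists2 m, coef c m != 0 & forall i, (i < m)%N -> coef c i = 0.
  move=> c0; have ex : exists m, coef c m != 0.
    apply: contrapT => /forallNP cz; case/eqP: c0; apply/fpsP => n.
    by have /negP/negbNE/eqP := cz n.
  exists (ex_minn ex); first by case: ex_minnP.
  case: ex_minnP => m _ mP i im; apply/eqP; apply: contraLR im => /mP.
  by rewrite leqNgt.
move=> /ord [m am mP] /ord [p bp pP].
apply/eqP => /fpsP /(_ (m + p)%N) /eqP; apply/negP; rewrite fps_coefM fps_coef0.
have mlt : (m < (m + p).+1)%N by rewrite ltnS leq_addr.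
rewrite (bigD1 (Ordinal mlt)) //= addKn big1 ?addr0 ?mulf_neq0 // => i.
rewrite -val_eqE neq_ltn => /orP[/mP ->|im]; first by rewrite mul0r.
have ile : (i <= m + p)%N by rewrite -ltnS.
by rewrite [coef b _]pP ?mulr0 // ltn_subLR // ltn_add2r.
Qed.

Lemma fps_mulfI (b : fps) : b != 0 -> injective ( *%R b).
Proof.
move=> b0 c c' /eqP; rewrite -subr_eq0 -mulrBr => h; apply/eqP.
rewrite -subr_eq0; apply: contraLR h; exact: fps_mulf_neq0.
Qed.

Lemma fps_divP (a b c : fps) : b != 0 -> b * c = a -> fps_div a b = c.
Proof.
move=> b0 bc; apply: (fps_mulfI b0); rewrite bc /fps_div.
by case: xgetP => [x _ //|/(_ c)]; case.
Qed.

Fixpoint sqrt_coefs (a : nat -> rat) (n : nat) : seq rat :=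
  if n is n'.+1 then
    let s := sqrt_coefs a n' in
    rcons s ((a n'.+1 - \sum_(i < n') s`_i.+1 * s`_(n' - i)) / 2)
  else [:: 1].

Lemma fps_sqrt_ex (a : fps) : coef a 0 = 1 ->
  exists s : fps, coef s 0 = 1 /\ s ^+ 2 = a.
Proof.
move=> a0; pose r n := (sqrt_coefs (coef a) n)`_n.
have sz n : size (sqrt_coefs (coef a) n) = n.+1.
  by elim: n => //= n ih; rewrite size_rcons ih.
have nthr n i : (i <= n)%N -> (sqrt_coefs (coef a) n)`_i = r i.
  elim: n => [|n ih]; first by rewrite leqn0 => /eqP ->.
  by rewrite leq_eqVlt => /predU1P[-> //|]; rewrite ltnS => /[dup] ? /ih <-;
     rewrite /= nth_rcons sz ltnS ifT.
exists (Fps r); split => //; apply/fpsP => -[|n]; rewrite expr2 fps_coefM.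
  by rewrite big_ord1 /= /r /= mulr1 a0.
have rS : r n.+1 = (coef a n.+1 - \sum_(i < n) r i.+1 * r (n - i)%N) / 2.
  rewrite {1}/r /= nth_rcons sz ltnn eqxx; congr ((_ - _) / _).
  by apply: eq_bigr => i _; rewrite !nthr ?leq_subr.
rewrite big_ord_recl big_ord_recr /= subn0 subnn.
have -> : r 0%N = 1 by [].
rewrite mul1r mulr1 addrCA -mulr2n -mulr_natr rS mulfVK //.
under eq_bigr => i _ do rewrite subSS.
by rewrite addrC subrK.
Qed.

Lemma fps_sqrtP (a : fps) : coef a 0 = 1 ->
  coef (fps_sqrt a) 0 = 1 /\ fps_sqrt a ^+ 2 = a.
Proof.
move=> /fps_sqrt_ex [s ss]; rewrite /fps_sqrt.
by case: xgetP => [x _ //|/(_ s)]; case.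
Qed.

(* A step (1, s) is encoded by its ordinate s : int, so up steps are s >= 1,  *)
(* horizontal steps s = 0 and down steps s = -1; a path is the list of its    *)
(* steps, and its length is its size.                                         *)
Definition end_height (p : seq int) : int := \sum_(s <- p) s.

Definition is_step (s : int) : bool := -1 <= s.

Definition nonneg_path (p : seq int) : Prop :=
  forall i, 0 <= end_height (take i p).

Definition preceded_by_down (p : seq int) : Prop :=
  forall i, (i.+1 < size p)%N -> 0 <= p`_i.+1 -> p`_i = -1.

Definition M'2 : set (seq int) :=
  [set p | [/\ all is_step p, nonneg_path p & preceded_by_down p]]%classic.

Definition M'2_paths (n k : nat) : set (seq int) :=
  [set p | [/\ M'2 p, size p = n & end_height p = k%:Z]]%classic.

Lemma finite_M'2_paths n k : finite_set (M'2_paths n k).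
Proof.
pose f (t : n.-tuple 'I_(n + k).+2) : seq int := [seq (nat_of_ord x)%:Z - 1 | x <- t].
apply: (@sub_finite_set _ _ [set f t | t in [set: n.-tuple 'I_(n + k).+2]]%classic);
  last exact/finite_image/finite_finset.
move=> p [[st _ _] sz ht].
have lb (q : seq int) : all is_step q -> - (size q)%:Z <= end_height q.
  rewrite /end_height; elim: q => [|x q ih] /=; first by rewrite big_nil.
  by case/andP=> x1 /ih h; rewrite big_cons intS opprD lerD.
have ub s : s \in p -> (absz (s + 1)%R < (n + k).+2)%N /\ 0 <= s + 1.
  move=> sp; have s1 : -1 <= s by apply: (allP st).
  have s0 : 0 <= s + 1 by rewrite -lerBlDr sub0r.
  split=> //; rewrite -ltz_nat (gez0_abs s0).
  have /lb : all is_step (rem s p).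
    by apply/allP => x /mem_rem; apply: (allP st).
  have : end_height p = s + end_height (rem s p).
    by rewrite /end_height (perm_big _ (perm_to_rem sp)) big_cons.
  rewrite ht size_rem // sz => e h.
  have -> : s = k%:Z - end_height (rem s p) by rewrite e addrK.
  apply: (@le_lt_trans _ _ (k%:Z + n.-1%:Z + 1)).
    by rewrite lerD2r lerD2l lerNl.
  by rewrite -!PoszD ltz_nat addn1 !ltnS addnC leq_add2r leq_pred.
have szt : size [seq inord (absz (s + 1)) : 'I_(n + k).+2 | s <- p] == n.
  by rewrite size_map sz.
exists (Tuple szt) => //; rewrite /f /= -map_comp -[RHS]map_id.
apply/eq_in_map => s; move=> /ub [h1 h2] /=.
by rewrite inordK // (gez0_abs h2) addrK.
Qed.

Definition t (n k : nat) : nat := #|` fset_set (M'2_paths n k)|.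

Definition infmx := nat -> nat -> rat.

(* A sum over all of nat, equal to 0 by convention if it has infinitely many *)
(* nonzero terms.                                                             *)
Definition infmx_mul (A B : infmx) : infmx :=
  fun n k => \sum_(j \in [set: nat]) A n j * B j k.

Definition almost_riordan (g0 g f : fps) : infmx :=
  fun n k => if k is k'.+1 then coef ('z * g * f ^+ k') n else coef g0 n.

Definition Tmx : infmx := fun n k => (t n k)%:R.

Definition Bmx : infmx := fun n k =>
  match n, k with
  | 0, 0 => 1
  | n'.+1, k'.+1 => 'C(k', n')%:R
  | _, _ => 0
  end.

Definition sqrtD : fps := fps_sqrt (1 - 2 * 'z - 3 * 'z ^+ 2).

Definition motzkin_gf : fps := fps_div (1 - 'z - sqrtD) (2 * 'z ^+ 2).

Definition g0 : fps := 1 + 'z * motzkin_gf.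

Definition g : fps :=
  fps_div (1 - 'z - 2 * 'z ^+ 2 - sqrtD) (2 * 'z ^+ 3 * (1 + 'z)).

Definition Amx : infmx := almost_riordan g0 g ('z ^+ 2 * g).

(* Main.v *)
Require Import Defs.
From mathcomp Require Import all_boot all_order all_algebra.
From mathcomp Require Import finmap boolp classical_sets cardinality fsbigop.
From mathcomp Require Import ring lra zify.
Import Order.TTheory GRing.Theory Num.Theory.
Local Open Scope ring_scope.

(** Both sides of T = A B obey the same recurrence in the length.

    On the combinatorial side, strip the end of a path. A down step may be
    appended to any path of positive height. A step s >= 0 other than the first one follows a down step, so
    the last two steps of such a path are -1, s and what precedes them is an
    arbitrary path, whose end height j + 1 determines s = k - j. This gives
      t (n + 2) k = t (n + 1) (k + 1) + \sum_(j <= k) t n (j + 1),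
    with t 0 k = [k = 0] and t 1 k = 1; lemmas [t0], [t1] and [t_rec].

    On the algebraic side, B is the binomial matrix, so the binomial theorem
    shows that column 0 of A B has generating function g0 and that column
    k + 1 has generating function z g h^k, where h = 1 + z^2 g ([AB_coef]). As
    z^2 g = h - 1, summing the geometric series shows that these columns obey
    the same recurrence as soon as
      g = h (z g + h)   and   g0 = 1 + z + z^2 (1 + z) g.
    Both come from the closed form of g, rewritten as
      sqrt (1 - 2z - 3z^2) = 1 - z - 2z^2 - 2z^3 (1 + z) g   ([sqrtDE]):
    squaring it gives the first ([g_eq]), and substituting it in the closed
    form of M gives the second ([motzkinE]). *)

(** * Appending a step to a path *)

Lemma end_height_rcons p s : end_height (rcons p s) = end_height p + s.
Proof. by rewrite /end_height -cats1 big_cat big_seq1. Qed.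

Lemma nonneg_path_rcons p s :
  nonneg_path (rcons p s) <-> nonneg_path p /\ 0 <= end_height (rcons p s).
Proof.
split=> [ge0|[ge0 ge0s] i].
  split=> [i|]; last by have := ge0 (size p).+1; rewrite take_oversize ?size_rcons.
  case: (leqP i (size p)) => [ip|/ltnW ip].
    by have := ge0 i; rewrite -cats1 takel_cat.
  by have := ge0 (size p); rewrite -cats1 takel_cat // take_size take_oversize.
case: (leqP i (size p)) => ip; first by rewrite -cats1 takel_cat.
by rewrite take_oversize ?size_rcons.
Qed.

Lemma preceded_by_down_rcons p s :
  preceded_by_down (rcons p s) <->
  preceded_by_down p /\ ((0 < size p)%N -> 0 <= s -> last 0 p = -1).
Proof.
rewrite /preceded_by_down size_rcons; split=> [pd|[pd ps] i].
  split=> [i ip|p0 s0].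
    by have := pd i; rewrite !nth_rcons ip (ltnW ip) ltnS (ltnW ip); apply.
  have := pd (size p).-1; rewrite !nth_rcons prednK // ltnn eqxx ltnSn.
  by rewrite leqnn nth_last; apply.
rewrite ltnS !nth_rcons => ip; rewrite ip; move: ip.
rewrite leq_eqVlt => /orP[/eqP pE|ip]; last by rewrite ip; apply: pd.
by rewrite pE ltnn eqxx => s0; rewrite -(ps _ s0) -?pE // -nth_last -pE.
Qed.

Lemma M'2_rcons p s : M'2 (rcons p s) <->
  [/\ M'2 p, is_step s, 0 <= end_height (rcons p s)
    & (0 < size p)%N -> 0 <= s -> last 0 p = -1].
Proof.
rewrite /M'2 /= all_rcons; split.
  by case=> /andP[st ps] /nonneg_path_rcons [p0 h0] /preceded_by_down_rcons [pd ls].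
case=> -[ps p0 pd] st h0 ls; split; first exact/andP.
  exact/nonneg_path_rcons.
exact/preceded_by_down_rcons.
Qed.

Lemma M'2_height_ge0 p : M'2 p -> 0 <= end_height p.
Proof. by case=> _ /(_ (size p)); rewrite take_size. Qed.

Lemma M'2_paths_rcons_down n k p :
  M'2_paths n.+1 k (rcons p (-1)) <-> M'2_paths n k.+1 p.
Proof.
rewrite /M'2_paths /= size_rcons end_height_rcons; split.
  case=> /M'2_rcons [pM _ _ _] [sp] hp; split=> //; lia.
case=> pM sp hp; split; [apply/M'2_rcons; split=> // | lia | lia].
by rewrite end_height_rcons; lia.
Qed.

(** The step before s is forced to be a down step, and a path may always be
    prolonged by a down step as long as its height is positive: hence no
    condition remains on q. The index j is the height just before s. *)
Lemma M'2_paths_rcons_up n k p (s : int) : 0 <= s ->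
  M'2_paths n.+2 k (rcons p s) <->
  exists q j, [/\ p = rcons q (-1), (j <= k)%N, s = k%:Z - j%:Z & M'2_paths n j.+1 q].
Proof.
move=> s0; split=> [[/M'2_rcons [pM _ _ pl]]|[q [j [-> jk sE qM]]]].
  rewrite size_rcons end_height_rcons => -[szp] hp.
  case/lastP: p pM szp hp pl => // q x pM; rewrite size_rcons last_rcons => szq hp pl.
  rewrite {}pl // in pM hp *; have h0 := M'2_height_ge0 _ pM.
  exists q, (absz (end_height (rcons q (-1)))); split=> //; [lia|lia|].
  apply/M'2_paths_rcons_down; by split; rewrite ?size_rcons ?gez0_abs.
have /M'2_paths_rcons_down [qdM qds qdh] := qM.
split; [|by rewrite size_rcons qds|by rewrite end_height_rcons qdh; lia].
apply/M'2_rcons; split=> //; first by rewrite /is_step; lia.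
  by rewrite end_height_rcons qdh; lia.
by rewrite last_rcons.
Qed.

(** * Counting paths *)

Lemma t_size n k (s : seq (seq int)) :
  uniq s -> (forall p, (p \in s) <-> M'2_paths n k p) -> t n k = size s.
Proof.
move=> us sP; apply/perm_size/uniq_perm => // p.
rewrite in_fset_set; last exact: finite_M'2_paths.
by apply/idP/idP => [/set_mem /sP|/sP /mem_set].
Qed.

Lemma t0 k : t 0 k = (k == 0)%N.
Proof.
rewrite (@t_size _ _ (if k == 0 then [:: [::]] else [::])%N); try by case: k.
have h0 : end_height [::] = 0 by rewrite /end_height big_nil.
move=> p; split=> [|[_ /size0nil -> hk]].
  case: k => //; rewrite inE => /eqP ->; split=> //; split=> // i.
  by rewrite h0.
by case: k hk => // k; rewrite h0.
Qed.

Lemma t1 k : t 1 k = 1%N.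
Proof.
rewrite (@t_size _ _ [:: [:: k%:Z]]) // => p; rewrite inE.
have h1 (x : int) : end_height [:: x] = x by rewrite /end_height big_seq1.
split=> [/eqP ->|[_ sp]].
  split=> //; apply/(M'2_rcons [::]); split=> //; last by rewrite /= h1.
  split=> // i; rewrite /end_height big_nil //.
by case: p sp => // x [] // _; rewrite h1 => ->.
Qed.

(** The two summands count the paths that end with a down step, and those that
    end with a down step followed by a step k - j >= 0. *)
Lemma t_rec n k : t n.+2 k = (t n.+1 k.+1 + \sum_(j < k.+1) t n j.+1)%N.
Proof.
pose P m h := enum_fset (fset_set (M'2_paths m h)).
have PP m h p : (p \in P m h) <-> M'2_paths m h p.
  rewrite /P in_fset_set; last exact: finite_M'2_paths.
  by split=> [/set_mem|/mem_set].
have Pu m h : uniq (P m h) by exact: fset_uniq.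
pose dn p : seq int := rcons p (-1).
pose up j p : seq int := rcons (rcons p (-1)) (k%:Z - j%:Z).
pose L := [seq dn p | p <- P n.+1 k.+1]
          ++ [seq up j p | j <- iota 0 k.+1, p <- P n j.+1].
have -> : t n.+2 k = size L.
  apply: t_size => [|p].
    rewrite cat_uniq map_inj_uniq => [|p q /rcons_inj [] //]; rewrite Pu andTb.
    apply/andP; split.
      apply/hasPn => _ /allpairsPdep [j [p [jk _ ->]]]; apply/mapP => -[q _].
      by move=> /rcons_inj [_]; move: jk; rewrite mem_iota; lia.
    apply: allpairs_uniq_dep => //; first exact: iota_uniq.
    (* The last step k - j recovers j, so distinct pairs give distinct paths. *)
    move=> [i p] [j q] _ _ /= /rcons_inj [/rcons_inj [->]] ij.
    by have -> : i = j by lia.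
  rewrite mem_cat; split=> [/orP[/mapP [q /PP qP ->]|]|pP].
  - exact/M'2_paths_rcons_down.
  - case/allpairsPdep => j [q [jk /PP qP ->]]; rewrite mem_iota in jk.
    apply/M'2_paths_rcons_up; first by lia.
    by exists q, j; split=> //; lia.
  case/lastP: p pP => [[] //|p s] pP.
  have [s0|s0] := leP 0 s.
    case/M'2_paths_rcons_up: pP => // q [j [-> jk -> /PP qP]].
    apply/orP; right; apply: allpairs_f_dep => //.
    by rewrite mem_iota; lia.
  have sE : s = -1.
    by case: (pP) => /M'2_rcons []; rewrite /is_step; lia.
  rewrite {}sE in pP *; apply/orP; left; apply: map_f; apply/PP.
  exact/M'2_paths_rcons_down.
rewrite size_cat size_map size_allpairs_dep sumnE big_map; congr (_ + _)%N.
by rewrite -[iota _ _]/(index_iota 0 k.+1) big_mkord.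
Qed.

(** * Coefficients and divisibility of power series *)

Lemma coef_sum I (r : seq I) (F : I -> fps) n :
  coef (\sum_(i <- r) F i) n = \sum_(i <- r) coef (F i) n.
Proof. by elim/big_rec2: _ => //= i y x _ <-. Qed.

Lemma coefMn a m n : coef (a *+ m) n = coef a n *+ m.
Proof. by elim: m => // m IH; rewrite !mulrS fps_coefD IH. Qed.

Lemma coef_natM m a n : coef (m%:R * a) n = m%:R * coef a n.
Proof. by rewrite !mulr_natl coefMn. Qed.

Lemma coef_nat m n : coef m%:R n = m%:R *+ (n == 0%N).
Proof. by rewrite coefMn fps_coef1; case: (n == 0%N); rewrite ?mul0rn ?mulr0n. Qed.

Lemma coef_zM a n : coef ('z * a) n = if n is n'.+1 then coef a n' else 0.
Proof.
case: n => [|n]; first by rewrite fps_coefM big_ord1 mul0r.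
rewrite fps_coefM big_ord_recl mul0r add0r big_ord_recl /= mul1r subSS subn0.
by rewrite big1 ?addr0 // => i _; rewrite mul0r.
Qed.

Lemma z_neq0 : 'z != 0 :> fps.
Proof. by apply/eqP => /fpsP /(_ 1%N) /eqP; rewrite oner_eq0. Qed.

Lemma two_neq0 : 2 != 0 :> fps.
Proof. by apply/eqP => /fpsP /(_ 0%N) /eqP; rewrite coefMn. Qed.

Lemma onez_neq0 : 1 + 'z != 0 :> fps.
Proof. by apply/eqP => /fpsP /(_ 0%N) /eqP; rewrite fps_coefD. Qed.

Lemma expfps_neq0 (a : fps) n : a != 0 -> a ^+ n != 0.
Proof.
by move=> a0; elim: n => [|n IH]; rewrite ?oner_eq0 // exprS fps_mulf_neq0.
Qed.

(** * The closed forms of g and M *)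

Lemma radicand_coef0 : coef (1 - 2 * 'z - 3 * 'z ^+ 2) 0 = 1.
Proof.
by rewrite !fps_coefD !fps_coefN !coef_natM expr2 coef_zM /= !mulr0 !subr0.
Qed.

Lemma sqrtD_sqr : sqrtD ^+ 2 = 1 - 2 * 'z - 3 * 'z ^+ 2.
Proof. by case: (fps_sqrtP radicand_coef0). Qed.

Lemma sqrtD_low : [/\ coef sqrtD 0 = 1, coef sqrtD 1 = -1 & coef sqrtD 2 = -2].
Proof.
have [s0 _] := fps_sqrtP radicand_coef0; rewrite -/sqrtD in s0.
have s1 : coef sqrtD 1 = -1.
  have /fpsP /(_ 1%N) := sqrtD_sqr; rewrite expr2 fps_coefM !big_ord_recl big_ord0.
  rewrite !fps_coefD !fps_coefN !coef_natM expr2 coef_zM /= /bump /= s0 subn0 addn0 => e.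
  lra.
split=> //.
have /fpsP /(_ 2) := sqrtD_sqr; rewrite expr2 fps_coefM !big_ord_recl big_ord0.
rewrite !fps_coefD !fps_coefN !coef_natM expr2 coef_zM /= /bump /= s0 subn0 !addn0 s1 => e.
lra.
Qed.

Lemma z_divides a : coef a 0 = 0 -> exists b, a = 'z * b.
Proof.
move=> a0; exists (Fps (fun n => coef a n.+1)); apply/fpsP => n.
by rewrite coef_zM; case: n.
Qed.

(** 2 (1 + z) is a unit, with inverse 1/2 times the alternating geometric
    series. *)
Lemma two_onez_divides a : exists b, a = 2 * (1 + 'z) * b.
Proof.
pose h := Fps (fun n => if n is 0%N then 2^-1 else 0).
pose v := Fps (fun n => (-1) ^+ n).
have h2 : 2 * h = 1.
  by apply/fpsP => -[|n]; rewrite coef_natM fps_coef1 /= ?mulr0 // divff.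
have v1 : (1 + 'z) * v = 1.
  apply/fpsP => n; rewrite mulrDl mul1r fps_coefD coef_zM fps_coef1.
  by case: n => [|n] /=; rewrite ?addr0 // exprS mulN1r addNr.
exists (h * v * a); transitivity ((2 * h) * ((1 + 'z) * v) * a); last by ring.
by rewrite h2 v1 !mul1r.
Qed.

(** The defining quotient of g is exact: the numerator is O(z^3), because sqrtD
    begins with 1 - z - 2z^2, and 2 (1 + z) is invertible. Since a quotient
    of series only makes sense when it is exact, every other fact about g
    goes through this equation. *)
Lemma sqrtDE : sqrtD = 1 - 'z - 2 * 'z ^+ 2 - 2 * 'z ^+ 3 * (1 + 'z) * g.
Proof.
suff [q qE] : exists q, 2 * 'z ^+ 3 * (1 + 'z) * q = 1 - 'z - 2 * 'z ^+ 2 - sqrtD.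
  rewrite /g (fps_divP _ qE); first by rewrite qE; ring.
  by rewrite !fps_mulf_neq0 ?expfps_neq0 ?two_neq0 ?z_neq0 ?onez_neq0.
have [s0 s1 s2] := sqrtD_low.
pose E := 1 - 'z - 2 * 'z ^+ 2 - sqrtD.
have En n : coef E n =
    (n == 0%N)%:R - (n == 1%N)%:R - 2 * (n == 2%N)%:R - coef sqrtD n.
  rewrite !fps_coefD !fps_coefN !coef_natM expr2 coef_zM fps_coef1.
  by case: n.
have [a aE] : exists a, E = 'z * a by apply: z_divides; rewrite En s0.
have [b bE] : exists b, a = 'z * b.
  by apply: z_divides; have /fpsP /(_ 1%N) := aE; rewrite coef_zM En s1 => <-.
have [c cE] : exists c, b = 'z * c.
  apply: z_divides; have /fpsP /(_ 2) := aE.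
  by rewrite bE (coef_zM _ 2) (coef_zM _ 1) En s2 => <-.
have [q qE] := two_onez_divides c.
by exists q; rewrite -/E aE bE cE qE; ring.
Qed.

Lemma motzkinE : motzkin_gf = 1 + 'z * (1 + 'z) * g.
Proof.
apply: fps_divP; first by rewrite !fps_mulf_neq0 ?expfps_neq0 ?two_neq0 ?z_neq0.
by rewrite sqrtDE; ring.
Qed.

Lemma g0_div : g0 = fps_div (1 + 'z - sqrtD) (2 * 'z).
Proof.
apply/esym/fps_divP; first by rewrite fps_mulf_neq0 ?two_neq0 ?z_neq0.
by rewrite /g0 motzkinE sqrtDE; ring.
Qed.

(** * The columns of the product *)

(** The series h of the introduction, called a ratio because column k + 2 of T is
    h times column k + 1. *)
Definition colratio : fps := 1 + 'z ^+ 2 * g.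

(** Squaring [sqrtDE] and cancelling 4 z^3 (1 + z) leaves a quadratic equation
    for g; grouping its terms by h = 1 + z^2 g puts it in this form. *)
Lemma g_eq : g = colratio * ('z * g + colratio).
Proof.
apply: (@fps_mulfI (2 * (2 * ('z ^+ 3 * (1 + 'z))))).
  by rewrite !fps_mulf_neq0 ?expfps_neq0 ?two_neq0 ?z_neq0 ?onez_neq0.
apply/eqP; rewrite -subr_eq0; apply/eqP.
transitivity ((1 - 2 * 'z - 3 * 'z ^+ 2) - sqrtD ^+ 2).
  by rewrite sqrtDE /colratio; ring.
by rewrite sqrtD_sqr subrr.
Qed.

Definition colT k : fps := if k is k'.+1 then 'z * g * colratio ^+ k' else g0.

(** A geometric series: z times column j + 1 is (h - 1) h^j. *)
Lemma colT_sum k : 'z * \sum_(j < k) colT j.+1 = colratio ^+ k - 1.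
Proof.
rewrite subrX1 !mulr_sumr; apply: eq_bigr => j _.
by rewrite /colT {2}/colratio; ring.
Qed.

(** The generating function form of [t_rec], with its initial values: the
    parenthesis, times z, collects the paths of positive length, and its summand 1
    those of length 1. *)
Lemma colT_rec k :
  colT k = (k == 0%N)%:R + 'z * (colT k.+1 + 1 + 'z * \sum_(j < k.+1) colT j.+1).
Proof.
rewrite colT_sum; case: k => [|k]; rewrite /colT /=.
  by rewrite /g0 motzkinE /colratio; ring.
by rewrite add0r {1}g_eq !exprS; ring.
Qed.

Lemma infmx_mul_col (A B : infmx) n k m :
  (forall j, (m <= j)%N -> B j k = 0) ->
  infmx_mul A B n k = \sum_(j < m) A n j * B j k.
Proof.
move=> B0; rewrite (fsbig_ord _ m (fun j => A n j * B j k)) /infmx_mul.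
apply/esym/fsbig_widen => // j /= [_ /negP]; rewrite -leqNgt => mj.
by rewrite B0 // mulr0.
Qed.

(** B is triangular, so the product is a finite sum, and its entries turn that
    sum, in column k + 1, into the binomial expansion of (1 + z^2 g)^k. *)
Lemma AB_coef n k : infmx_mul Amx Bmx n k = coef (colT k) n.
Proof.
rewrite (@infmx_mul_col _ _ _ _ k.+1) => [|j]; last first.
  by case: k j => [|k] [|j] //; rewrite ltnS => kj; rewrite /Bmx bin_small.
rewrite big_ord_recl; case: k => [|k].
  by rewrite big_ord0 addr0 /= mulr1.
rewrite mulr0 add0r /colT /colratio exprDn mulr_sumr coef_sum.
apply: eq_bigr => j _; by rewrite expr1n mul1r mulr_natr mulrnAr coefMn.
Qed.

Theorem proposition8 :
  g0 = fps_div (1 + 'z - sqrtD) (2 * 'z)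
  /\ forall n k : nat, Tmx n k = infmx_mul Amx Bmx n k.
Proof.
split=> [|n k]; first exact: g0_div.
rewrite AB_coef /Tmx; elim/ltn_ind: n k => -[|[|n]] IH k;
  rewrite colT_rec fps_coefD coef_nat coef_zM.
- by rewrite t0 addr0.
- by rewrite t1 !fps_coefD coef_zM -(IH 0%N) // t0 /= addr0 !add0r.
rewrite t_rec natrD natr_sum !fps_coefD coef_zM coef_sum add0r addr0 -IH //.
by congr (_ + _); apply: eq_bigr => j _; apply: IH; lia.
Qed.
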